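(* Let $p$ be a prime, $n$ a positive integer which is a multiple of $p-1$, and $u\in\mathbb{Z}_p^\times$. The canonical homomorphism $\pi:\mathbb{D}_n^\times\to\mathbb{G}_n(u)$ induces a canonical bijection $$\widetilde{\mathcal{F}}_u(\mathbb{D}_n^\times)\longrightarrow\mathcal{F}(\mathbb{G}_n(u)).$$ This bijection passes to conjugacy classes.
   Context: $\mathbb{D}_n$ is the central division algebra over $\mathbb{Q}_p$ of Hasse invariant $1/n$, $\mathbb{G}_n(u)=\mathbb{D}_n^\times/\langle pu\rangle$, and $\pi$ is the quotient map. $\mathcal{F}(\mathbb{G}_n(u))$ is the set of all finite subgroups of $\mathbb{G}_n(u)$; $\widetilde{\mathcal{F}}_u(\mathbb{D}_n^\times)$ is the set of all subgroups of $\mathbb{D}_n^\times$ which contain $\langle pu\rangle$ as a subgroup of finite index. The map sends a subgroup $H$ to $\pi(H)$; passing to conjugacy classes means that it induces a bijection between $\mathbb{D}_n^\times$-conjugacy classes of elements of the source and $\mathbb{G}_n(u)$-conjugacy classes of elements of the target. *)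

(* Defs.v *)
From HB Require Import structures.
From mathcomp Require Import all_boot all_order all_algebra all_field.
From mathcomp Require Import generic_quotient fraction.
From mathcomp Require Import boolp classical_sets functions cardinality.

Set Implicit Arguments.
Unset Strict Implicit.
Unset Printing Implicit Defensive.

Import GRing.Theory Num.Theory.
Local Open Scope classical_set_scope.

(* Z_p as the inverse limit of the rings Z/p^i; the class modulo p^i is
   given by its representative in [0, p^i), a bound which the compatibility
   condition forces. *)
Record padic_int (p : nat) (p_pr : prime p) := PadicInt {
  residue :> nat -> nat;
  residueP : forall i, residue i = (residue i.+1 %% p ^ i)%N }.

Section PadicInt.
Variables (p : nat) (p_pr : prime p).
Local Notation Z_p := (padic_int p_pr).
Local Open Scope nat_scope.

HB.instance Definition _ := gen_eqMixin Z_p.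
HB.instance Definition _ := gen_choiceMixin Z_p.

Lemma padic_int_ext (x y : Z_p) : x =1 y -> x = y.
Proof.
case: x y => [x xP] [y yP] /= /funext exy.
by case: y / exy yP => yP; congr PadicInt; apply: Prop_irrelevance.
Qed.

Lemma residue_lt (x : Z_p) i : x i < p ^ i.
Proof. by rewrite residueP ltn_mod expn_gt0 prime_gt0. Qed.

Lemma residue_mod (x : Z_p) i : x i %% p ^ i = x i.
Proof. by rewrite modn_small ?residue_lt. Qed.

Lemma modn_expS m i : (m %% p ^ i.+1) %% p ^ i = m %% p ^ i.
Proof. by rewrite modn_dvdm // dvdn_exp2l. Qed.

Lemma residue_le (x : Z_p) i j : i <= j -> x j = x i %[mod p ^ i].
Proof.
elim: j => [|j IHj]; first by rewrite leqn0 => /eqP ->.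
rewrite leq_eqVlt => /predU1P[-> //|ij].
by rewrite -IHj // [in RHS]residueP modn_dvdm // dvdn_exp2l.
Qed.

Lemma padic_nat_subproof n i : n %% p ^ i = (n %% p ^ i.+1) %% p ^ i.
Proof. by rewrite modn_expS. Qed.

Definition padic_nat n : Z_p :=
  @PadicInt p p_pr (fun i => n %% p ^ i) (padic_nat_subproof n).

Lemma padic_add_subproof (x y : Z_p) i :
  (x i + y i) %% p ^ i = ((x i.+1 + y i.+1) %% p ^ i.+1) %% p ^ i.
Proof. by rewrite modn_expS (residueP x) (residueP y) modnDm. Qed.

Definition padic_add (x y : Z_p) : Z_p :=
  @PadicInt p p_pr (fun i => (x i + y i) %% p ^ i) (padic_add_subproof x y).

Lemma padic_mul_subproof (x y : Z_p) i :
  (x i * y i) %% p ^ i = ((x i.+1 * y i.+1) %% p ^ i.+1) %% p ^ i.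
Proof. by rewrite modn_expS (residueP x) (residueP y) modnMm. Qed.

Definition padic_mul (x y : Z_p) : Z_p :=
  @PadicInt p p_pr (fun i => (x i * y i) %% p ^ i) (padic_mul_subproof x y).

Lemma padic_opp_subproof (x : Z_p) i :
  (p ^ i - x i) %% p ^ i = ((p ^ i.+1 - x i.+1) %% p ^ i.+1) %% p ^ i.
Proof.
rewrite modn_expS; apply/eqP; rewrite -(eqn_modDr (x i.+1)).
rewrite subnK; last exact/ltnW/residue_lt.
rewrite -modnDmr -(residueP x) subnK; last exact/ltnW/residue_lt.
by rewrite modnn expnS modnMl.
Qed.

Definition padic_opp (x : Z_p) : Z_p :=
  @PadicInt p p_pr (fun i => (p ^ i - x i) %% p ^ i) (padic_opp_subproof x).

Lemma padic_addA : associative padic_add.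
Proof.
by move=> x y z; apply: padic_int_ext => i /=; rewrite modnDml modnDmr addnA.
Qed.

Lemma padic_addC : commutative padic_add.
Proof. by move=> x y; apply: padic_int_ext => i /=; rewrite addnC. Qed.

Lemma padic_add0 : left_id (padic_nat 0) padic_add.
Proof.
by move=> x; apply: padic_int_ext => i /=; rewrite mod0n add0n residue_mod.
Qed.

Lemma padic_addN : left_inverse (padic_nat 0) padic_opp padic_add.
Proof.
move=> x; apply: padic_int_ext => i /=; rewrite modnDml mod0n.
by rewrite subnK ?modnn //; exact/ltnW/residue_lt.
Qed.

Lemma padic_mulA : associative padic_mul.
Proof.
by move=> x y z; apply: padic_int_ext => i /=; rewrite modnMml modnMmr mulnA.
Qed.

Lemma padic_mulC : commutative padic_mul.
Proof. by move=> x y; apply: padic_int_ext => i /=; rewrite mulnC. Qed.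

Lemma padic_mul1 : left_id (padic_nat 1) padic_mul.
Proof.
by move=> x; apply: padic_int_ext => i /=; rewrite modnMml mul1n residue_mod.
Qed.

Lemma padic_mulDl : left_distributive padic_mul padic_add.
Proof.
move=> x y z; apply: padic_int_ext => i /=.
by rewrite modnMml modnDm mulnDl.
Qed.

Lemma padic_nat1_neq0 : padic_nat 1 != padic_nat 0.
Proof.
apply/eqP => /(congr1 (fun x : Z_p => x 1)) /=; rewrite mod0n expn1.
by rewrite modn_small ?prime_gt1.
Qed.

HB.instance Definition _ := GRing.isZmodule.Build Z_p
  padic_addA padic_addC padic_add0 padic_addN.
HB.instance Definition _ := GRing.Zmodule_isComNzRing.Build Z_p
  padic_mulA padic_mulC padic_mul1 padic_mulDl padic_nat1_neq0.

Definition padic_int_unit : {pred Z_p} :=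
  fun x => `[< exists y : Z_p, (y * x = 1)%R >].

Definition padic_int_inv (x : Z_p) : Z_p :=
  if pselect (exists y : Z_p, (y * x = 1)%R) is left ex then sval (cid ex)
  else x.

Lemma padic_mulV :
  {in padic_int_unit, left_inverse 1%R padic_int_inv *%R}.
Proof.
move=> x /asboolP ex; rewrite /padic_int_inv.
by case: pselect => // ex'; case: (cid ex').
Qed.

Lemma padic_unitP (x y : Z_p) : (y * x = 1)%R -> padic_int_unit x.
Proof. by move=> yx; apply/asboolP; exists y. Qed.

Lemma padic_inv_out : {in [predC padic_int_unit], padic_int_inv =1 id}.
Proof.
move=> x; rewrite inE /= => /asboolPn nex.
by rewrite /padic_int_inv; case: pselect.
Qed.

HB.instance Definition _ := GRing.ComNzRing_hasMulInverse.Build Z_p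
  padic_mulV padic_unitP padic_inv_out.

Lemma residue0 i : (0%R : Z_p) i = 0.
Proof. exact: mod0n. Qed.

Lemma padic_int_neq0 (x : Z_p) : x != 0%R -> exists i, x i != 0.
Proof.
move=> x0; apply: contrapT => nx; case/eqP: x0; apply: padic_int_ext => i.
rewrite residue0; apply: contrapT => xi; apply: nx.
by exists i; apply/eqP.
Qed.

Lemma padic_int_integral : GRing.integral_domain_axiom Z_p.
Proof.
move=> x y xy0; apply: contraT; rewrite negb_or.
case/andP => /padic_int_neq0[i xi] /padic_int_neq0[j yj].
have ndvd (z : Z_p) k l : z k != 0 -> k <= l -> ~~ (p ^ k %| z l).
  by move=> zk kl; rewrite /dvdn residue_le // residue_mod.
have nx := ndvd _ _ _ xi (leq_addr j i).
have ny := ndvd _ _ _ yj (leq_addl i j).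
have pos (z k l : nat) : ~~ (p ^ k %| l) -> 0 < l.
  by case: l => //; rewrite dvdn0.
have x0 := pos 0 _ _ nx; have y0 := pos 0 _ _ ny.
rewrite (pfactor_dvdn _ p_pr x0) -ltnNge in nx.
rewrite (pfactor_dvdn _ p_pr y0) -ltnNge in ny.
have /eqP : (x * y)%R (i + j) = 0 by rewrite xy0 residue0.
rewrite -[_ == 0]/(p ^ (i + j) %| x (i + j) * y (i + j)).
rewrite pfactor_dvdn ?muln_gt0 ?x0 // lognM // leqNgt.
by rewrite -addnS leq_add // ltnW.
Qed.

HB.instance Definition _ :=
  GRing.ComUnitRing_isIntegral.Build Z_p padic_int_integral.

Lemma natr_padic_int n : (n%:R = padic_nat n :> Z_p)%R.
Proof.
elim: n => // n IHn; rewrite -addn1 natrD IHn.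
by apply: padic_int_ext => i /=; rewrite modnDm.
Qed.

Lemma padic_int_p_neq0 : (p%:R != 0 :> Z_p)%R.
Proof.
rewrite natr_padic_int; apply/eqP => /(congr1 (fun x : Z_p => x 2)) /=.
rewrite mod0n modn_small => [/eqP|]; first by rewrite -leqn0 leqNgt prime_gt0.
by rewrite -{1}(expn1 p) ltn_exp2l ?prime_gt1.
Qed.

End PadicInt.

Notation padic p_pr := {fraction (padic_int p_pr)}.
Notation "x %:F" := (FracField.tofrac x) : ring_scope.

Section PadicValuation.
Variables (p : nat) (p_pr : prime p).
Local Open Scope ring_scope.

(* meaningful for x != 0 only *)
Definition padic_val (x : padic p_pr) : int :=
  xget 0 [set k : int | exists2 w : padic_int p_pr,
    w \is a GRing.unit & x = (p%:R)%:F ^ k * w%:F].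

End PadicValuation.

Section Hasse.
Variables (p : nat) (p_pr : prime p) (D : falgType (padic p_pr)).
Local Open Scope ring_scope.

Definition central_division_algebra : Prop :=
  (forall x : D, x != 0 -> x \is a GRing.unit) /\ ('Z({:D}) = 1)%VS.

Definition regular_norm (x : D) : padic p_pr :=
  \det (passmx.mxof (vbasis {:D}) (vbasis {:D}) (amull x)).

(* The unique valuation of D extending the p-adic one, with v(p) = 1; it is
   meaningful for x != 0 only. *)
Definition division_val (x : D) : rat :=
  (padic_val (regular_norm x))%:~R / (\dim {:D})%:R.

Definition in_valuation_ring (x : D) := x = 0 \/ 0 <= division_val x.
Definition in_maximal_ideal (x : D) := x = 0 \/ 0 < division_val x.

(* A subfield L of D containing Q_p, of degree the index of D, and with the
   same value group as Q_p. *)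
Definition maximal_unramified_subfield (L : {aspace D}) : Prop :=
  [/\ 1 \in L,
      {in L &, commutative *%R},
      (\dim L ^ 2 = \dim {:D})%N &
      forall x, x \in L -> x != 0 -> division_val x \is a Num.int].

(* s induces on L, by x |-> s x s^-1, the automorphism which lifts
   x |-> x ^ p on the residue field of L; the residue field of Q_p has p
   elements. *)
Definition induces_frobenius (L : {aspace D}) (s : D) : Prop :=
  s != 0 /\ forall x, x \in L ->
    s * x * s^-1 \in L /\
    (in_valuation_ring x -> in_maximal_ideal (s * x * s^-1 - x ^+ p)).

(* inv(D) is the class of r in Q/Z, where inv(D) is the class of v(s) for s
   inducing the Frobenius automorphism on a maximal unramified subfield. *)
Definition hasse_invariant (r : rat) : Prop :=
  exists (L : {aspace D}) (s : D),
    [/\ maximal_unramified_subfield L, induces_frobenius L s &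
        division_val s - r \is a Num.int].

End Hasse.

Section UnitGroup.
Variable R : unitRingType.
Local Open Scope ring_scope.

Record unit_group := UnitGroup {
  unit_val : R;
  unit_valP : unit_val \is a GRing.unit }.

HB.instance Definition _ := [isSub for unit_val].
HB.instance Definition _ := [Choice of unit_group by <:].

Implicit Types x y z : unit_group.

Definition unit_one := UnitGroup (unitr1 R).

Lemma unit_mul_subproof x y : val x * val y \is a GRing.unit.
Proof. by rewrite unitrMl ?unit_valP. Qed.
Definition unit_mul x y := UnitGroup (unit_mul_subproof x y).

Lemma unit_inv_subproof x : (val x)^-1 \is a GRing.unit.
Proof. by rewrite unitrV unit_valP. Qed.
Definition unit_inv x := UnitGroup (unit_inv_subproof x).

Lemma unit_mulA : associative unit_mul.
Proof. by move=> x y z; apply: val_inj; rewrite /= mulrA. Qed.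
Lemma unit_mul1 : left_id unit_one unit_mul.
Proof. by move=> x; apply: val_inj; rewrite /= mul1r. Qed.
Lemma unit_mulr1 : right_id unit_one unit_mul.
Proof. by move=> x; apply: val_inj; rewrite /= mulr1. Qed.
Lemma unit_mulV : left_inverse unit_one unit_inv unit_mul.
Proof. by move=> x; apply: val_inj; rewrite /= mulVr ?unit_valP. Qed.
Lemma unit_mulrV : right_inverse unit_one unit_inv unit_mul.
Proof. by move=> x; apply: val_inj; rewrite /= mulrV ?unit_valP. Qed.

HB.instance Definition _ := isGroup.Build unit_group
  unit_mulA unit_mul1 unit_mulr1 unit_mulV unit_mulrV.

End UnitGroup.

Local Open Scope group_scope.

Definition is_subgroup (G : groupType) (H : set G) : Prop := group_closed (mem H).

Record normal_subgroup (G : groupType) := NormalSubgroup {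
  nsg_set :> set G;
  nsg_subgroup : is_subgroup nsg_set;
  nsg_normal : forall x y : G, nsg_set x -> nsg_set (x ^ y) }.

Section Quotient.
Variables (G : groupType) (N : normal_subgroup G).
Implicit Types x y z : G.

Definition same_coset : rel G := fun x y => `[< nsg_set N (x^-1 * y) >].

Lemma nsg1 : nsg_set N 1.
Proof. by have [/set_mem] := nsg_subgroup N. Qed.

Lemma nsgV x : nsg_set N x -> nsg_set N x^-1.
Proof.
by move=> Nx; apply/set_mem/(group_closedV (nsg_subgroup N))/mem_set.
Qed.

Lemma nsgM x y : nsg_set N x -> nsg_set N y -> nsg_set N (x * y).
Proof.
move=> Nx Ny; apply/set_mem.
by apply: (group_closedM (nsg_subgroup N)); apply: mem_set.
Qed.

Lemma same_coset_refl : reflexive same_coset.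
Proof. by move=> x; apply/asboolP; rewrite mulVg; exact: nsg1. Qed.

Lemma same_coset_sym : symmetric same_coset.
Proof.
have sub x y : same_coset x y -> same_coset y x.
  by move=> /asboolP /nsgV; rewrite invgM invgK => ?; apply/asboolP.
by move=> x y; apply/idP/idP; apply: sub.
Qed.

Lemma same_coset_trans : transitive same_coset.
Proof.
move=> y x z /asboolP xy /asboolP yz; apply/asboolP.
by rewrite -(mulgK y x^-1) -mulgA; exact: nsgM.
Qed.

Canonical same_coset_equiv :=
  EquivRel same_coset same_coset_refl same_coset_sym same_coset_trans.

Local Open Scope quotient_scope.

Definition quotient_group := {eq_quot same_coset}.
HB.instance Definition _ := Choice.on quotient_group.
HB.instance Definition _ := EqQuotient.on quotient_group.

Definition quotient_map (x : G) : quotient_group := \pi x.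

Lemma quotient_mapP x y :
  quotient_map x = quotient_map y <-> nsg_set N (x^-1 * y).
Proof.
by split=> [/eqmodP/asboolP // | Nxy]; apply/eqmodP/asboolP.
Qed.

Lemma quotient_map_surj (a : quotient_group) : quotient_map (repr a) = a.
Proof. exact: reprK. Qed.

Definition quotient_mul (a b : quotient_group) := quotient_map (repr a * repr b).
Definition quotient_inv (a : quotient_group) := quotient_map (repr a)^-1.

Lemma quotient_mulE x y :
  quotient_mul (quotient_map x) (quotient_map y) = quotient_map (x * y).
Proof.
rewrite /quotient_mul; set x' := repr _; set y' := repr _.
have /quotient_mapP Nx : quotient_map x' = quotient_map x.
  exact: quotient_map_surj.
have /quotient_mapP Ny : quotient_map y' = quotient_map y.
  exact: quotient_map_surj.
apply/quotient_mapP.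
rewrite (_ : _ * _ = (x'^-1 * x) ^ y' * (y'^-1 * y)).
  by apply: nsgM => //; exact: nsg_normal.
by rewrite conjgE invgM !mulgA mulgK.
Qed.

Lemma quotient_invE x : quotient_inv (quotient_map x) = quotient_map x^-1.
Proof.
rewrite /quotient_inv; set x' := repr _.
have /quotient_mapP Nx : quotient_map x = quotient_map x'.
  by rewrite quotient_map_surj.
apply/quotient_mapP; rewrite invgK.
by have := nsg_normal x^-1 Nx; rewrite conjgE invgK -mulgA mulVKg.
Qed.

Lemma quotient_mulA : associative quotient_mul.
Proof.
move=> a b c; rewrite -(quotient_map_surj a) -(quotient_map_surj b).
by rewrite -(quotient_map_surj c) !quotient_mulE mulgA.
Qed.

Lemma quotient_mul1 : left_id (quotient_map 1) quotient_mul.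
Proof.
by move=> a; rewrite -(quotient_map_surj a) quotient_mulE mul1g.
Qed.

Lemma quotient_mulr1 : right_id (quotient_map 1) quotient_mul.
Proof.
by move=> a; rewrite -(quotient_map_surj a) quotient_mulE mulg1.
Qed.

Lemma quotient_mulV : left_inverse (quotient_map 1) quotient_inv quotient_mul.
Proof.
move=> a; rewrite -(quotient_map_surj a) quotient_invE quotient_mulE.
by rewrite mulVg.
Qed.

Lemma quotient_mulrV : right_inverse (quotient_map 1) quotient_inv quotient_mul.
Proof.
move=> a; rewrite -(quotient_map_surj a) quotient_invE quotient_mulE.
by rewrite mulgV.
Qed.

HB.instance Definition _ := isGroup.Build quotient_group
  quotient_mulA quotient_mul1 quotient_mulr1 quotient_mulV quotient_mulrV.

Lemma quotient_mapM : {morph quotient_map : x y / x * y}.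
Proof. by move=> x y; rewrite -quotient_mulE. Qed.

HB.instance Definition _ :=
  isMultiplicative.Build G quotient_group quotient_map quotient_mapM.

End Quotient.

Section Subgroups.
Variable G : groupType.

Definition cycle_set (c : G) : set G :=
  [set x | exists n : nat, x = c ^+ n \/ x = c ^- n].

Lemma cycle_set_subgroup (c : G) : is_subgroup (cycle_set c).
Proof.
have cc n : commute c (c ^+ n) by apply: commuteX.
split; first by apply/mem_set; exists 0%N; left.
have sub m n : cycle_set c (c ^+ m / c ^+ n).
  case: (leqP n m) => nm.
    by exists (m - n)%N; left; rewrite expgnFr.
  exists (n - m)%N; right; rewrite expgnFr 1?ltnW //.
  by rewrite invgF.
move=> x y /set_mem[m xE] /set_mem[n yE]; apply/mem_set.
case: xE yE => -> [] ->.
- exact: sub.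
- by rewrite invgK -expgnDr; exists (m + n)%N; left.
- by rewrite -invgM -expgnDr; exists (n + m)%N; right.
- rewrite invgK (_ : _ * _ = c ^+ n / c ^+ m) //.
  by apply/commute_sym/commuteV/commuteX2.
Qed.

Lemma cycle_set_normal (c : G) : (forall x, commute c x) ->
  forall x y : G, cycle_set c x -> cycle_set c (x ^ y).
Proof.
move=> cG x y [n xE]; exists n.
have cy : (c ^+ n) ^ y = c ^+ n.
  by rewrite conjgE (commute_sym (commuteX n (commute_sym (cG y)))) mulKg.
by case: xE => ->; [left | right]; rewrite ?conjVg cy.
Qed.

Definition central_cycle (c : G) (cG : forall x, commute c x) :=
  NormalSubgroup (cycle_set_subgroup c) (cycle_set_normal cG).

Definition left_cosets (N H : set G) : set (set G) :=
  [set [set x * y | y in N] | x in H].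

Definition finite_subgroups : set (set G) :=
  [set H | is_subgroup H /\ finite_set H].

Definition finite_index_oversubgroups (N : set G) : set (set G) :=
  [set H | [/\ is_subgroup H, N `<=` H & finite_set (left_cosets N H)]].

Definition conj_class (H : set G) : set (set G) :=
  range (fun g : G => [set x ^ g | x in H]).

Definition conj_classes (F : set (set G)) : set (set (set G)) :=
  conj_class @` F.

End Subgroups.

Section Gu.
Variables (p : nat) (p_pr : prime p) (D : falgType (padic p_pr)).
Variable u : unit_group (padic_int p_pr).
Local Open Scope ring_scope.

Lemma pu_subproof : ((p%:R * val u)%:F%:A : D) \is a GRing.unit.
Proof.
have pu0 : (p%:R * val u)%:F != 0 :> padic p_pr.
  rewrite tofrac_eq0 mulf_eq0 negb_or padic_int_p_neq0 /=.
  apply: contraTneq (unit_valP u) => ->.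
  by rewrite unitr0.
by rewrite scaler_unit ?unitr1 ?unitfE.
Qed.

Definition pu : unit_group D := UnitGroup pu_subproof.

Lemma pu_central (x : unit_group D) : commute pu x.
Proof. by apply: val_inj; rewrite /= mulr_algl mulr_algr. Qed.

Definition pu_cycle : normal_subgroup (unit_group D) := central_cycle pu_central.

Definition Gu := quotient_group pu_cycle.

HB.instance Definition _ := Group.on Gu.

Definition Gu_map : unit_group D -> Gu := @quotient_map _ pu_cycle.

End Gu.

Arguments Gu_map {p p_pr} D u _.
Arguments finite_subgroups G : clear implicits.

(* Main.v *)
(* This is the correspondence theorem for the quotient by a normal subgroup N:
   a subgroup containing N is the full preimage of its image.  The coset x N is
   the fibre of the quotient map over the class of x, so the left cosets of N
   in H are in bijection with the image of H, and finite index of N in H amounts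
   to finiteness of that image.  Since the quotient map is surjective, it maps
   conjugacy classes of subgroups onto conjugacy classes of subgroups. *)
Require Import Defs.
From HB Require Import structures.
From mathcomp Require Import all_boot all_order all_algebra all_field.
From mathcomp Require Import boolp classical_sets functions cardinality.

Set Implicit Arguments.
Unset Strict Implicit.
Unset Printing Implicit Defensive.

Import GRing.Theory Num.Theory.
Local Open Scope ring_scope.
Local Open Scope classical_set_scope.

Section SubgroupMorphism.
Variables (G H : groupType) (f : G -> H).
Hypothesis fF : {morph f : x y / (x / y)%g}.
Local Open Scope group_scope.

(** [is_subgroup] asks for [1] and closure under division, so [fF] is the natural hypothesis; it
    yields [f 1 = 1] through [1 / 1]. It is met by the quotient map and by conjugation alike. *)
Lemma is_subgroup_image (A : set G) : is_subgroup A -> is_subgroup (f @` A).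
Proof.
move=> [/set_mem A1 AF]; split.
  by apply/mem_set; exists 1 => //; rewrite -(divgg 1) fF divgg.
move=> _ _ /set_mem[x Ax <-] /set_mem[y Ay <-]; apply/mem_set.
by exists (x / y) => //; apply/set_mem/AF; apply/mem_set.
Qed.

Lemma is_subgroup_preimage (B : set H) :
  is_subgroup B -> is_subgroup (f @^-1` B).
Proof.
move=> [/set_mem B1 BF]; split.
  by apply/mem_set; rewrite /preimage /= -(divgg 1) fF divgg.
move=> x y /set_mem Bx /set_mem By; apply/mem_set; rewrite /preimage /= fF.
by apply/set_mem/BF; apply/mem_set.
Qed.

End SubgroupMorphism.

Section Correspondence.
Variables (G : groupType) (N : normal_subgroup G).
Local Open Scope group_scope.
Implicit Types (H : set G) (K : set (quotient_group N)).
Local Notation f := (@quotient_map G N).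
Local Notation F := (finite_index_oversubgroups N).

(** The unit of the quotient is by construction the class of [1], whence [erefl]. *)
HB.instance Definition _ :=
  Multiplicative_isUMagmaMorphism.Build G (quotient_group N) f (erefl 1).

Lemma quotient_map_preimageK K : f @` (f @^-1` K) = K.
Proof.
apply: image_preimage; apply/seteqP; split=> // a _.
by exists (repr a) => //; exact: quotient_map_surj.
Qed.

(** If [f x = f y] with [y] in [H], then [y^-1 * x] lies in [N], hence in [H], and so does
    [x = y * (y^-1 * x)]. *)
Lemma quotient_map_imageK H :
  is_subgroup H -> N `<=` H -> f @^-1` (f @` H) = H.
Proof.
move=> Hgrp NH; apply/seteqP; split=> [x [y Hy /quotient_mapP/NH Hyx]|].
  rewrite -(mulVKg y x); apply/set_mem.
  by apply: (group_closedM Hgrp); apply/mem_set.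
exact: preimage_image.
Qed.

Lemma left_cosetE (x : G) : [set x * y | y in N] = f @^-1` [set f x].
Proof.
apply/seteqP; split=> [_ [y Ny <-]|y fxy].
  by apply/esym/quotient_mapP; rewrite mulKg.
by exists (x^-1 * y); [apply/quotient_mapP | rewrite mulVKg].
Qed.

Lemma finite_left_cosets H :
  finite_set (left_cosets N H) <-> finite_set (f @` H).
Proof.
have -> : left_cosets N H = (fun a => f @^-1` [set a]) @` (f @` H).
  rewrite image_comp; apply: eq_imagel => x _; exact: left_cosetE.
(* Taking fibres is injective: since [f] is surjective, the image of the fibre over [a] is [[set a]]
   again. *)
rewrite (eq_finite_set (inj_card_eq _)) // => a b _ _ ab.
suff : [set a] b by [].
by rewrite -(quotient_map_preimageK [set a]) ab quotient_map_preimageK.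
Qed.

(** Normality keeps [N] inside the conjugate, and the image of the conjugate is the conjugate by
    [f g] of a finite set. Thus whole conjugacy classes stay in [F], where the map on subgroups is
    injective. *)
Lemma finite_index_oversubgroups_conj H (g : G) :
  F H -> F [set x ^ g | x in H].
Proof.
move=> [Hgrp NH /finite_left_cosets finH]; split.
- apply: is_subgroup_image Hgrp => x y; by rewrite conjMg conjVg.
- move=> x Nx; exists (x ^ g^-1); last by rewrite conjgKV.
  by apply/NH/nsg_normal.
- apply/finite_left_cosets; rewrite image_comp.
  rewrite (eq_imagel (f' := (fun a => a ^ f g) \o f)).
    by rewrite -image_comp; exact: finite_image.
  by move=> x _; rewrite /= gmulfJ.
Qed.

Lemma image_quotient_map_inj : set_inj F (fun H => f @` H).
Proof.
move=> H1 H2 /set_mem[g1 N1 _] /set_mem[g2 N2 _] eqf.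
by rewrite -(quotient_map_imageK g1 N1) eqf quotient_map_imageK.
Qed.

Lemma image_quotient_map_bij :
  set_bij F (finite_subgroups (quotient_group N)) (fun H => f @` H).
Proof.
split; [|exact: image_quotient_map_inj|].
  move=> H [Hgrp NH /finite_left_cosets finH]; split=> //.
  exact: (is_subgroup_image (gmulfF f)).
move=> K [Kgrp finK]; exists (f @^-1` K); last exact: quotient_map_preimageK.
have pgrp := is_subgroup_preimage (gmulfF f) Kgrp.
split=> //; last by apply/finite_left_cosets; rewrite quotient_map_preimageK.
(* Elements of [N] have the same class as [1], which every subgroup contains. *)
move=> x Nx; have -> : (f @^-1` K) x = K 1.
  rewrite /preimage /=; congr K.
  by apply/esym/quotient_mapP; rewrite invg1 mul1g.
by case: Kgrp => /set_mem.
Qed.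

(** Every conjugating element [a] of the quotient lifts to [repr a], so no conjugate of the image is
    missed. *)
Lemma image_conj_class H :
  (fun A => f @` A) @` conj_class H = conj_class (f @` H).
Proof.
have fJ (g : G) : f @` [set x ^ g | x in H] = [set a ^ f g | a in f @` H].
  by rewrite !image_comp; apply: eq_imagel => x _; rewrite /= gmulfJ.
apply/seteqP; split=> [_ [_ [g _ <-] <-]|_ [a _ <-]].
  by exists (f g) => //; rewrite fJ.
rewrite -(quotient_map_surj a); exists [set x ^ repr a | x in H].
  by exists (repr a).
exact: fJ.
Qed.

Lemma image_quotient_map_conj_bij :
  set_bij (conj_classes F) (conj_classes (finite_subgroups (quotient_group N)))
          (fun C => (fun H => f @` H) @` C).
Proof.
have [fun_f inj_f surj_f] := image_quotient_map_bij.
have sub H : F H -> conj_class H `<=` F.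
  by move=> FH _ [g _ <-]; exact: finite_index_oversubgroups_conj.
split.
- by move=> _ [H FH <-]; exists (f @` H); [exact: fun_f|rewrite image_conj_class].
(* A member [A] of [C1] has the same image as some [B] in [C2]; both lie in [F], so injectivity on
   subgroups gives [B = A]. *)
- have inc C1 C2 : C1 `<=` F -> C2 `<=` F ->
      (fun H => f @` H) @` C1 = (fun H => f @` H) @` C2 -> C1 `<=` C2.
    move=> s1 s2 eqC A C1A.
    have [B C2B fBA] : ((fun H => f @` H) @` C2) (f @` A).
      by rewrite -eqC; exists A.
    suff <- : B = A by [].
    by apply: inj_f => //; apply/mem_set; [exact: s2|exact: s1].
  move=> _ _ /set_mem[H1 /sub F1 <-] /set_mem[H2 /sub F2 <-] eqC.
  by apply/seteqP; split; apply: inc.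
- move=> _ [K FK <-]; have [H FH <-] := surj_f _ FK.
  by exists (conj_class H); [exists H | rewrite image_conj_class].
Qed.

End Correspondence.

Theorem proposition2p1 (p : nat) (p_pr : prime p) (n : nat) (n_gt0 : (0 < n)%N)
    (n_mul : (p.-1 %| n)%N) (u : unit_group (padic_int p_pr))
    (D : falgType (padic p_pr)) (D_cda : central_division_algebra D)
    (D_inv : hasse_invariant D n%:R^-1) :
  set_bij (finite_index_oversubgroups (pu_cycle D u))
          (finite_subgroups (Gu D u))
          (fun H => Gu_map D u @` H) /\
  set_bij (conj_classes (finite_index_oversubgroups (pu_cycle D u)))
          (conj_classes (finite_subgroups (Gu D u)))
          (fun C => (fun H => Gu_map D u @` H) @` C).
Proof.
(* [Gu_map D u] unfolds to the quotient map by [pu_cycle D u]. *)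
split; [exact: image_quotient_map_bij|exact: image_quotient_map_conj_bij].
Qed.
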